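(* Let $f\in\mathbb{Z}[u^{\pm1}]$ be an irreducible nonhyperbolic polynomial which is not cyclotomic, and let $\alpha=\alpha_{R_1/(f)}$ be the ergodic and nonexpansive automorphism of the compact connected abelian group $X=X_{R_1/(f)}$. Then $\Delta_\alpha(X)=\{0\}$.
   Context: Let $R_1=\mathbb{Z}[u^{\pm1}]$ and let $f=f_0+\dots+f_mu^m\in R_1$ be irreducible with $m>0$, $f_m>0$, $f_0\ne 0$. The polynomial $f$ is nonhyperbolic if it has a root of absolute value $1$, and cyclotomic if it has a root which is a root of unity. With $\mathbb{T}=\mathbb{R}/\mathbb{Z}$, $X_{R_1/(f)}=\{x\in\mathbb{T}^{\mathbb{Z}}:\sum_{j=0}^m f_jx_{k+j}=0 \text{ for every } k\in\mathbb{Z}\}$, and $\alpha_{R_1/(f)}$ is the restriction to $X_{R_1/(f)}$ of the shift $\tau(x)_n=x_{n+1}$. For a continuous automorphism $\alpha$ of a compact abelian group $X$, $\Delta_\alpha(X)=\{x\in X:\lim_{|n|\to\infty}\alpha^nx=0\}$ is the group of $\alpha$-homoclinic points. *)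

(* Defs.v *)
From HB Require Import structures.
From mathcomp Require Import all_boot all_order all_algebra.
From mathcomp Require Import generic_quotient ring_quotient complex.
From mathcomp Require Import all_classical all_reals all_analysis.

Set Implicit Arguments.
Unset Strict Implicit.
Unset Printing Implicit Defensive.

Import Order.TTheory GRing.Theory Num.Theory.
Import numFieldNormedType.Exports.
Local Open Scope classical_set_scope.
Local Open Scope ring_scope.

(* Z[u^{+-1}] is realised as the subring of the fractions p / u^n in the
   fraction field of Z[u]; units and irreducibility are those of this subring,
   not of Z[u]. *)

Definition laurent (g : {fraction {poly int}}) : Prop :=
  exists (n : nat) (p : {poly int}), g * FracField.tofrac 'X^n = FracField.tofrac p.

Definition laurent_unit (g : {fraction {poly int}}) : Prop :=
  laurent g /\ exists h, laurent h /\ g * h = 1.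

Definition laurent_irreducible (g : {fraction {poly int}}) : Prop :=
  [/\ laurent g, g <> 0, ~ laurent_unit g &
      forall a b, laurent a -> laurent b -> g = a * b ->
        laurent_unit a \/ laurent_unit b].

Definition nonhyperbolic (R : realType) (f : {poly int}) : Prop :=
  exists z : R[i], root (map_poly intr f) z /\ `|z| = 1.

Definition cyclotomic (R : realType) (f : {poly int}) : Prop :=
  exists z : R[i], root (map_poly intr f) z /\
    exists n : nat, (0 < n)%N /\ z ^+ n = 1.

Section Torus.
Variable R : realType.

(* [Num.int] is a qualifier: restated as a predicate so that it can carry the
   zmodClosed structure needed by the quotient. *)
Definition integers : {pred R} := fun x => x \is a Num.int.

Fact integers_zmod_closed : zmod_closed integers.
Proof.
split=> [|x y]; rewrite !unfold_in; first exact: rpred0.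
exact: rpredB.
Qed.
HB.instance Definition _ :=
  GRing.isZmodClosed.Build R integers integers_zmod_closed.

Definition torus := quotient_topology (Quotient.quot integers).

HB.instance Definition _ := Quotient.on torus.
HB.instance Definition _ := Topological.on torus.
HB.instance Definition _ := GRing.isZmodule.Build torus
  (@Quotient.addqA _ integers) (@Quotient.addqC _ integers)
  (@Quotient.add0q _ integers) (@Quotient.addNq _ integers).

Definition to_torus : R -> torus := \pi_(torus)%qT.

Lemma to_torusB : {morph to_torus : x y / x - y}.
Proof.
move=> x y; rewrite [LHS](@Quotient.pi_add _ integers x (- y)).
by rewrite (@Quotient.pi_opp _ integers).
Qed.

Lemma to_torus_eq x y : to_torus x = to_torus y <-> x - y \is a Num.int.
Proof.
rewrite -[_ \is a _]/(x - y \in integers) (@Quotient.idealrBE _ integers).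
by split=> [h|/eqP//]; apply/eqP.
Qed.

Lemma to_torus_surj (t : torus) : exists x, t = to_torus x.
Proof. by exists (repr t); rewrite /to_torus reprK. Qed.

Lemma to_torus_continuous : continuous to_torus.
Proof. exact: pi_continuous. Qed.

Lemma to_torus_open (U : set R) : open U -> open (to_torus @` U).
Proof.
move=> oU; rewrite /open/= /quotient_open.
have -> : \pi_(torus)%qT @^-1` (to_torus @` U) =
    \bigcup_(k : int) ((fun x => x + k%:~R) @^-1` U).
  apply/seteqP; split=> [x [y Uy /to_torus_eq /intrP[k yxE]]|x [k _ Ux]].
    by exists k => //=; rewrite -yxE addrC subrK.
  exists (x + k%:~R) => //; apply/to_torus_eq.
  by rewrite addrAC subrr add0r intr_int.
apply: bigcup_open => k _; apply: open_comp => // x _.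
by apply: cvgD; [exact: cvg_id|exact: cvg_cst].
Qed.

Lemma torus_sub_continuous : continuous (fun t : torus * torus => t.1 - t.2).
Proof.
move=> [a b] /=; have [x ->] := to_torus_surj a; have [y ->] := to_torus_surj b.
move=> U /=; rewrite -to_torusB => nU.
have : continuous (fun z : R * R => to_torus (z.1 - z.2)).
  move=> z; apply: (@continuous_comp _ _ _ (fun z : R * R => z.1 - z.2)).
    exact: sub_continuous.
  exact: to_torus_continuous.
move=> /(_ (x, y) U nU) [[V W] /= [nV nW] VWU].
exists (to_torus @` interior V, to_torus @` interior W) => /=.
  split; apply: open_nbhs_nbhs; split.
  - by apply: to_torus_open; exact: open_interior.
  - by exists x.
  - by apply: to_torus_open; exact: open_interior.
  - by exists y.
move=> [_ _] /= [[v Vv <-] [w Ww <-]].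
rewrite -to_torusB; apply: (VWU (v, w)).
by split=> /=; exact: nbhs_singleton.
Qed.

HB.instance Definition _ :=
  PreTopologicalNmodule_isTopologicalZmodule.Build torus torus_sub_continuous.

End Torus.

Section Bisequences.
Variable R : realType.

Definition biseq := prod_topology (fun _ : int => torus R).

HB.instance Definition _ := Topological.on biseq.
HB.instance Definition _ := GRing.Zmodule.copy biseq (int -> torus R).

Lemma biseq_continuousP (S : topologicalType) (g : S -> biseq) :
  (forall k, continuous (fun s => g s k)) -> continuous g.
Proof.
move=> gc s; apply/cvg_sup => k; move: s.
by apply: continuous_comp_initial; exact: gc.
Qed.

Lemma biseq_eval_continuous k : continuous (fun x : biseq => x k).
Proof. exact: (@proj_continuous int (fun=> torus R) k). Qed.

Lemma biseq_sub_continuous : continuous (fun x : biseq * biseq => x.1 - x.2).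
Proof.
apply: biseq_continuousP => k z.
have c1 : continuous (fun z : biseq * biseq => z.1 k).
  move=> t; apply: (@continuous_comp _ _ _ fst (fun x : biseq => x k)).
    exact: cvg_fst.
  exact: biseq_eval_continuous.
have c2 : continuous (fun z : biseq * biseq => z.2 k).
  move=> t; apply: (@continuous_comp _ _ _ snd (fun x : biseq => x k)).
    exact: cvg_snd.
  exact: biseq_eval_continuous.
apply: (@continuous_comp _ (torus R * torus R)%type _
  (fun z : biseq * biseq => (z.1 k, z.2 k)) (fun t => t.1 - t.2)).
  exact: cvg_pair (c1 z) (c2 z).
exact: sub_continuous.
Qed.

HB.instance Definition _ :=
  PreTopologicalNmodule_isTopologicalZmodule.Build biseq biseq_sub_continuous.

End Bisequences.

Section Xgroup.
Variables (R : realType) (f : {poly int}).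

Definition Xset : set (biseq R) :=
  [set x | forall k : int, \sum_(j < size f) x (k + (j : nat)%:Z) *~ f`_j = 0].

Fact Xset_zmod_closed : zmod_closed (mem Xset).
Proof.
split=> [|x y].
  by apply: mem_set => k; rewrite big1 // => j _; exact: mul0rz.
move=> /set_mem Xx /set_mem Xy; apply: mem_set => k.
under eq_bigr do rewrite mulrzBl.
by rewrite sumrB Xx Xy subrr.
Qed.

Definition X : Type := set_type Xset.
HB.instance Definition _ := SubChoice.on X.
HB.instance Definition _ := Topological.on X.
HB.instance Definition _ :=
  GRing.SubChoice_isSubZmodule.Build (biseq R) _ X Xset_zmod_closed.

Lemma val_X_continuous : continuous (\val : X -> biseq R).
Proof. exact: initial_continuous. Qed.

Lemma X_sub_continuous : continuous (fun x : X * X => x.1 - x.2).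
Proof.
apply: continuous_comp_initial => z.
have c1 : continuous (fun z : X * X => \val z.1).
  move=> t; apply: (@continuous_comp _ X _ fst (\val : X -> biseq R)).
    exact: cvg_fst.
  exact: val_X_continuous.
have c2 : continuous (fun z : X * X => \val z.2).
  move=> t; apply: (@continuous_comp _ X _ snd (\val : X -> biseq R)).
    exact: cvg_snd.
  exact: val_X_continuous.
apply: (@continuous_comp _ (biseq R * biseq R)%type _
  (fun z : X * X => (\val z.1, \val z.2)) (fun t => t.1 - t.2)).
  exact: cvg_pair (c1 z) (c2 z).
exact: sub_continuous.
Qed.

HB.instance Definition _ :=
  PreTopologicalNmodule_isTopologicalZmodule.Build X X_sub_continuous.

End Xgroup.

Arguments Xset : clear implicits.

Record automorphism (G : topologicalZmodType) := Automorphism {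
  aut_fun :> G -> G;
  aut_inv : G -> G;
  aut_funD : {morph aut_fun : x y / x + y};
  aut_funK : cancel aut_fun aut_inv;
  aut_invK : cancel aut_inv aut_fun;
  aut_fun_continuous : continuous aut_fun;
  aut_inv_continuous : continuous aut_inv
}.

Definition aut_iter (G : topologicalZmodType) (a : automorphism G) (n : int) :
    G -> G :=
  match n with
  | Posz m => iter m a
  | Negz m => iter m.+1 (aut_inv a)
  end.

(* The filter of the limit |n| -> oo on Z: both ends at once. *)
Definition abs_infty : set_system int :=
  [set A | exists N : nat, forall n : int, (N <= `|n|)%N -> A n].

Definition homoclinic (G : topologicalZmodType) (a : automorphism G) : set G :=
  [set x | aut_iter a n x @[n --> abs_infty] --> (0 : G)].

Global Instance abs_infty_proper : ProperFilter abs_infty.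
Proof.
split; first by move=> [N] /(_ N%:Z); apply; rewrite absz_nat.
split.
- by exists 0%N.
- move=> A B [N NA] [M MB]; exists (maxn N M) => n.
  by rewrite geq_max => /andP[/NA ? /MB ?].
- by move=> A B AB [N NA]; exists N => n /NA /AB.
Qed.

Section Shift.
Variables (R : realType) (f : {poly int}).

Definition translate (d : int) (x : biseq R) : biseq R := fun n => x (n + d).

Lemma translate_continuous d : continuous (translate d).
Proof. by apply: biseq_continuousP => k; exact: biseq_eval_continuous. Qed.

Lemma translate_Xset d x : x \in Xset R f -> translate d x \in Xset R f.
Proof.
move=> /set_mem Xx; apply: mem_set => k; rewrite -[RHS](Xx (k + d)).
by apply: eq_bigr => j _; rewrite /translate addrAC.
Qed.

Definition translate_X d (x : X R f) : X R f :=
  exist _ (translate d (\val x)) (translate_Xset d (valP x)).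

Lemma translate_X_continuous d : continuous (translate_X d).
Proof.
apply: continuous_comp_initial => x.
apply: (@continuous_comp _ (biseq R) _ (\val : X R f -> _) (translate d)).
  exact: val_X_continuous.
exact: translate_continuous.
Qed.

Lemma translate_XD d : {morph translate_X d : x y / x + y}.
Proof. by move=> x y; apply: val_inj. Qed.

Lemma translate_XK d : cancel (translate_X d) (translate_X (- d)).
Proof.
move=> x; apply: val_inj; apply: funext => n /=.
by rewrite /translate addrAC -addrA subrr addr0.
Qed.

Lemma translate_XNK d : cancel (translate_X (- d)) (translate_X d).
Proof. by rewrite -{2}[d]opprK; exact: translate_XK. Qed.

Definition alpha : automorphism (X R f) :=
  Automorphism (translate_XD 1) (translate_XK 1) (translate_XNK 1)
    (@translate_X_continuous 1) (@translate_X_continuous (- 1)).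

Lemma alphaE (x : X R f) n : \val (alpha x) n = \val x (n + 1).
Proof. by []. Qed.

End Shift.

(* Main.v *)
Require Import Defs.
From mathcomp Require Import all_boot all_order all_algebra.
From mathcomp Require Import complex.
From mathcomp Require Import all_classical all_reals all_analysis.
From mathcomp Require Import ring lra zify.
Import Order.TTheory GRing.Theory Num.Theory.
Import numFieldNormedType.Exports.
Local Open Scope classical_set_scope.
Local Open Scope ring_scope.


(** Lift a homoclinic point x to a real bisequence y with entries in
    [-1/2, 1/2[; since x tends to 0 in the torus, y tends to 0 at both ends.
    Let z := f(shift) y.  It is integer valued because x satisfies the
    relations of f modulo 1, and it tends to 0, so it has finite support: it is
    a Laurent polynomial.

    Let w be a root of f on the unit circle and write f = (u - w) g over C.
    Then t := g(shift) y tends to 0 and satisfies t(k+1) = w t(k) + z(k).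
    Beyond the support of z the modulus of t is constant, hence 0, and solving
    the recurrence across the support gives exactly the vanishing at w of the
    polynomial built from z ([generating_poly_root]).  As f is irreducible it
    divides that polynomial in Z[u^{+-1}] ([laurent_irreducible_dvd]), which
    says that z = f(shift) h with h integer valued of finite support.

    Now y - h tends to 0 and is killed by f(shift).  Splitting f into linear
    factors over C, it suffices that v(k+1) = a v(k) has no nonzero solution
    that tends to 0 at both ends: one of the two ends contradicts |a| >= 1 or
    |a| <= 1 ([shift_op_vanishing_eq0]).  So y = h is integer valued, and
    x = 0. *)

(** * Polynomials in the shift *)

Definition shift_op {A : nzRingType} (p : {poly A}) (v : int -> A) (k : int) :=
  \sum_(j < size p) p`_j * v (k + (j : nat)%:Z).

(** A range independent of the size of [p] lets operators of different
    polynomials be compared term by term. *)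
Lemma shift_op_widen {A : nzRingType} (n : nat) (p : {poly A}) v k :
  (size p <= n)%N -> shift_op p v k = \sum_(j < n) p`_j * v (k + (j : nat)%:Z).
Proof.
move=> pn; rewrite /shift_op (big_ord_widen _ (fun j => p`_j * v (k + j%:Z)) pn).
rewrite big_mkcond; apply: eq_bigr => j _; case: ltnP => // /(nth_default 0) ->.
by rewrite mul0r.
Qed.

Lemma shift_opD {A : nzRingType} (p q : {poly A}) v k :
  shift_op (p + q) v k = shift_op p v k + shift_op q v k.
Proof.
pose n := maxn (size p) (size q).
rewrite !(@shift_op_widen _ n) ?leq_maxl ?leq_maxr ?size_polyD//.
by rewrite -big_split; apply: eq_bigr => j _; rewrite coefD mulrDl.
Qed.

Lemma shift_opZ {A : nzRingType} (c : A) (p : {poly A}) v k :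
  shift_op (c *: p) v k = c * shift_op p v k.
Proof.
rewrite (@shift_op_widen _ (size p)) ?size_scale_leq// mulr_sumr.
by apply: eq_bigr => j _; rewrite coefZ mulrA.
Qed.

Lemma shift_opMX {A : nzRingType} (p : {poly A}) v k :
  shift_op (p * 'X) v k = shift_op p v (k + 1).
Proof.
rewrite (@shift_op_widen _ (size p).+1).
  rewrite big_ord_recl coefMX mul0r add0r; apply: eq_bigr => j _.
  by rewrite coefMX /= /bump leq0n add1n -addrA -intS.
by rewrite (leq_trans (size_polyMleq _ _))// size_polyX addn2.
Qed.

Lemma shift_op1 {A : nzRingType} (v : int -> A) k : shift_op 1 v k = v k.
Proof. by rewrite /shift_op size_poly1 big_ord1 coef1 mul1r addr0. Qed.

Lemma shift_opXsubCM {A : comNzRingType} (a : A) (p : {poly A}) v k :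
  shift_op (('X - a%:P) * p) v k = shift_op p v (k + 1) - a * shift_op p v k.
Proof.
rewrite mulrBl mulrC mul_polyC -scaleNr shift_opD shift_opMX shift_opZ.
by rewrite mulNr.
Qed.

Lemma shift_opB {A : nzRingType} (p : {poly A}) u v k :
  shift_op p (fun n => u n - v n) k = shift_op p u k - shift_op p v k.
Proof. by rewrite -sumrB; apply: eq_bigr => j _; rewrite mulrBr. Qed.

Lemma shift_op_map {A B : nzRingType} (phi : {rmorphism A -> B})
    (p : {poly A}) v k :
  shift_op (map_poly phi p) (fun n => phi (v n)) k = phi (shift_op p v k).
Proof.
rewrite (@shift_op_widen _ (size p)) ?size_poly// rmorph_sum.
by apply: eq_bigr => j _; rewrite coef_map rmorphM.
Qed.

(** Extending the coefficients by 0 to negative exponents makes the convolution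
    formula for a product valid at every integer. *)
Definition coef_int {A : nzRingType} (q : {poly A}) (i : int) : A :=
  if i is Posz n then q`_n else 0.

Lemma coef_intMX {A : nzRingType} (q : {poly A}) i :
  coef_int (q * 'X) i = coef_int q (i - 1).
Proof.
case: i => [[|n]|n] //; first by rewrite /= coefMX.
have -> : n.+1%:Z - 1 = n by lia.
by rewrite /= coefMX.
Qed.

(** The coefficients of [q], read backwards, form a bisequence on which [p]
    applied to the shift acts as multiplication by [p]. *)
Lemma coef_intM {A : comNzRingType} (p q : {poly A}) (c k : int) :
  coef_int (p * q) (c - k) = shift_op p (fun n => coef_int q (c - n)) k.
Proof.
elim/poly_ind: p k => [|p a IH] k.
  rewrite mul0r /shift_op size_poly0 big_ord0.
  by case: (c - k) => //= n; rewrite coef0.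
rewrite shift_opD shift_opMX -IH -[a%:P]mulr1 mul_polyC shift_opZ shift_op1.
rewrite mulrDl mulrAC -scalerAl mul1r opprD addrA -coef_intMX.
by case: (c - k) => [n|n] /=; rewrite ?coefD ?coefZ// mulr0 addr0.
Qed.

(** * Bisequences tending to zero at both ends *)

Definition vanishing {K : numFieldType} (v : int -> K) :=
  forall e : K, 0 < e -> \forall n \near abs_infty, `|v n| < e.

Lemma vanishingD {K : numFieldType} (u v : int -> K) :
  vanishing u -> vanishing v -> vanishing (fun n => u n + v n).
Proof.
move=> u0 v0 e e0; have e2 : 0 < e / 2 by rewrite divr_gt0.
apply: filterS2 (u0 _ e2) (v0 _ e2) => n un vn.
by rewrite [e]splitr (le_lt_trans (ler_normD _ _))// ltrD.
Qed.

Lemma vanishingZ {K : numFieldType} (c : K) v :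
  vanishing v -> vanishing (fun n => c * v n).
Proof.
move=> v0 e e0; have c0 : 0 < `|c| + 1 by rewrite ltr_wpDl.
apply: filterS (v0 (e / (`|c| + 1)) _) => [n|]; last by rewrite divr_gt0.
rewrite ltr_pdivlMr// normrM => /(le_lt_trans _); apply.
by rewrite mulrC ler_wpM2l// lerDl.
Qed.

Lemma vanishing_shift {K : numFieldType} (d : int) (v : int -> K) :
  vanishing v -> vanishing (fun n => v (n + d)).
Proof.
move=> v0 e /v0[N vN]; exists (N + `|d|)%N => n Nn; apply: vN; lia.
Qed.

Lemma vanishing_shift_op {K : numFieldType} (p : {poly K}) v :
  vanishing v -> vanishing (shift_op p v).
Proof.
move=> v0; elim/poly_ind: p => [|p c IH].
  move=> e e0; exists 0%N => n _.
  by rewrite /shift_op size_poly0 big_ord0 normr0.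
have -> : shift_op (p * 'X + c%:P) v = fun k => shift_op p v (k + 1) + c * v k.
  apply: funext => k; rewrite shift_opD shift_opMX -[c%:P]mulr1 mul_polyC.
  by rewrite shift_opZ shift_op1.
by apply: vanishingD; [exact: vanishing_shift|exact: vanishingZ].
Qed.

Lemma vanishing_recurrent {K : numFieldType} (v : int -> K) (c : K) :
  vanishing v ->
  (forall n : nat, exists2 k : int, (n <= `|k|)%N & `|c| <= `|v k|) -> c = 0.
Proof.
move=> v0 cv; apply/eqP; apply: contraT; rewrite -normr_gt0 => /v0[N vN].
by have [k /vN vk /le_lt_trans/(_ vk)] := cv N; rewrite ltxx.
Qed.

(** A solution is a geometric progression: its modulus is non-increasing or
    non-decreasing, so each of its values is dominated arbitrarily far out
    towards one of the two ends. *)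
Lemma vanishing_first_order {C : numClosedFieldType} (a : C) (v : int -> C) :
  vanishing v -> (forall k, v (k + 1) = a * v k) -> forall k, v k = 0.
Proof.
move=> v0 va k.
have pow (i : int) (n : nat) : v (i + n%:Z) = a ^+ n * v i.
  elim: n => [|n IH]; first by rewrite addr0 mul1r.
  have -> : i + n.+1%:Z = i + n%:Z + 1 by lia.
  by rewrite va IH exprS mulrA.
apply: (vanishing_recurrent v) => // n.
have /orP[a1|a1] : (`|a| <= 1) || (1 <= `|a|).
- by apply: real_leVge; rewrite ?realE ?normr_ge0 ?ler01.
- exists (k - (n + `|k|)%N%:Z); first lia.
  rewrite -{1}[k](subrK (n + `|k|)%N%:Z) pow normrM normrX.
  by rewrite ler_piMl// exprn_ile1.
- exists (k + (n + `|k|)%N%:Z); first lia.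
  by rewrite pow normrM normrX ler_peMl// exprn_ege1.
Qed.

(** Over an algebraically closed field the linear factors of [p] can be removed
    one at a time, each being injective on vanishing bisequences. *)
Lemma shift_op_vanishing_eq0 {C : numClosedFieldType} (p : {poly C})
    (v : int -> C) :
  p != 0 -> vanishing v -> (forall k, shift_op p v k = 0) -> forall k, v k = 0.
Proof.
move=> p0 v0; have [r ->] := closed_field_poly_normal p.
move=> pv; have {pv}: forall k, shift_op (\prod_(z <- r) ('X - z%:P)) v k = 0.
  move=> k; have /eqP := pv k; rewrite shift_opZ mulf_eq0 lead_coef_eq0.
  by rewrite (negPf p0) => /eqP.
elim: r => [|a r IH] rv k.
  by rewrite -[RHS](rv k) big_nil shift_op1.
apply: IH => // {}k; move: k; apply: (vanishing_first_order a).
  exact: vanishing_shift_op.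
move=> k; apply/eqP; rewrite -subr_eq0 -shift_opXsubCM.
by move: (rv k); rewrite big_cons => ->.
Qed.

Lemma vanishing_intr {K : numFieldType} (z : int -> int) :
  vanishing (fun n => (z n)%:~R : K) ->
  exists N : nat, forall n : int, (N <= `|n|)%N -> z n = 0.
Proof.
move=> /(_ 1 ltr01) [N zN]; exists N => n /zN /=.
rewrite -intr_norm ltrz1 -abszE ltz_nat ltnS leqn0 absz_eq0.
by move/eqP.
Qed.

Lemma vanishing_coef_int {K : numFieldType} (q : {poly int}) (c : int) :
  vanishing (fun k => (coef_int q (c - k))%:~R : K).
Proof.
move=> e e0; exists (size q + `|c|)%N => k kq /=.
suff -> : coef_int q (c - k) = 0 by rewrite normr0.
case E: (c - k) => [i|//] /=; apply: nth_default.
by move: (size q) kq => m; lia.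
Qed.

(** * Divisibility by the irreducible polynomial *)

(** Solving the recurrence from [- N], where [t] is 0, up to [N], where it is 0
    again, gives the sum of the [z k * w ^+ (N - 1 - k)], which is the value
    at [w] of the polynomial. *)
Lemma generating_poly_root {C : numClosedFieldType} (w : C) (z : int -> int)
    (t : int -> C) (N : nat) :
  `|w| = 1 -> vanishing t -> (forall n : int, (N <= `|n|)%N -> z n = 0) ->
  (forall k, t (k + 1) = w * t k + (z k)%:~R) ->
  root (map_poly intr (\poly_(l < N + N) z (N%:Z - 1 - l%:Z))) w.
Proof.
move=> w1 t0 zN tz.
have tN : t (- N%:Z) = 0.
  (* Outside the support of [z] the modulus of [t] is constant, which for a
     vanishing [t] leaves only the value 0. *)
  have tm (n : nat) : `|t (- N%:Z)| = `|t (- N%:Z - n%:Z)|.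
    elim: n => [|n ->]; first by rewrite subr0.
    have -> : - N%:Z - n%:Z = - N%:Z - n.+1%:Z + 1 by lia.
    by rewrite tz zN ?addr0 ?normrM ?w1 ?mul1r//; lia.
  apply: (vanishing_recurrent t) => // n; exists (- N%:Z - n%:Z); first lia.
  by rewrite -tm.
have tP : t N%:Z = 0.
  have tp (n : nat) : `|t N%:Z| = `|t (N%:Z + n%:Z)|.
    elim: n => [|n ->]; first by rewrite addr0.
    have -> : N%:Z + n.+1%:Z = N%:Z + n%:Z + 1 by lia.
    by rewrite tz zN ?addr0 ?normrM ?w1 ?mul1r//; lia.
  apply: (vanishing_recurrent t) => // n; exists (N%:Z + n%:Z); first lia.
  by rewrite -tp.
have tsum (M : nat) : t (- N%:Z + M%:Z) =
    \sum_(l < M) (z (- N%:Z + M%:Z - 1 - (l : nat)%:Z))%:~R * w ^+ l.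
  elim: M => [|M IH]; first by rewrite big_ord0 addr0.
  have -> : - N%:Z + M.+1%:Z = - N%:Z + M%:Z + 1 by lia.
  rewrite tz IH big_ord_recl subr0 expr0 mulr1 addrK addrC; congr (_ + _).
  rewrite mulr_sumr; apply: eq_bigr => l _; rewrite mulrCA -exprS.
  by congr ((z _)%:~R * _); rewrite /= /bump; lia.
apply/rootP; rewrite (@horner_coef_wide _ (N + N)); last first.
  by rewrite (leq_trans (size_poly _ _))// size_poly.
rewrite -[RHS]tP; have -> : N%:Z = - N%:Z + (N + N)%N%:Z by lia.
rewrite tsum; apply: eq_bigr => l _; rewrite coef_map coef_poly ltn_ord.
by congr ((z _)%:~R * _); lia.
Qed.

(** The gcd of [f] and [g] over Z is, up to nonzero constants, a combination of
    [f] and [g], so [w] is a root of its primitive part.  A unit of the Laurent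
    ring divides a monomial and cannot vanish at [w]; hence the factor that
    irreducibility makes a unit is the cofactor of the primitive part in [f],
    and [g] is a multiple of [f] up to a monomial.  Taking the primitive part
    rather than the gcd itself makes the cofactors integral. *)
Lemma laurent_irreducible_dvd {C : numClosedFieldType} (f g : {poly int})
    (w : C) :
  laurent_irreducible (FracField.tofrac f) -> w != 0 ->
  root (map_poly intr f) w -> root (map_poly intr g) w ->
  exists (n : nat) (q : {poly int}), 'X^n * g = f * q.
Proof.
move=> [_ f0 _ f_irr] w0 /rootP fw /rootP gw.
have [[u v] /= /eqpP[[a b] /= /andP[_ b0] uvd]] := Bezoutp f g.
have [s fE] := dvdpP_int (dvdp_gcdl f g).
have [r gE] := dvdpP_int (dvdp_gcdr f g).
set d := gcdp f g in uvd fE gE.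
have d0 : d != 0 by rewrite gcdp_eq0 negb_and -tofrac_eq0 (introN eqP f0).
have dw : (map_poly intr (zprimitive d)).[w] = 0 :> C.
  have c0 : (b * zcontents d)%:~R != 0 :> C.
    by rewrite intr_eq0 mulf_neq0// zcontents_eq0.
  apply: (mulfI c0); rewrite mulr0.
  have /esym := congr1 (fun p => (map_poly intr p).[w] : C) uvd.
  rewrite /= {1}[d]zpolyEprim scalerA !map_polyZ !hornerZ rmorphD !rmorphM.
  by rewrite hornerD !hornerM fw gw !mulr0 addr0 mulr0.
have lau (p : {poly int}) : laurent (FracField.tofrac p).
  by exists 0%N, p; rewrite expr0 tofrac1 mulr1.
have unitE (p : {poly int}) : laurent_unit (FracField.tofrac p) ->
    exists (n : nat) (q : {poly int}), p * q = 'X^n.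
  move=> [_ [h [[n [q hq]] ph]]]; exists n, q; apply/eqP.
  by rewrite -tofrac_eq tofracM -hq mulrA ph mul1r.
have := f_irr _ _ (lau (zprimitive d)) (lau s).
rewrite {1}fE tofracM => /(_ erefl) [/unitE [n [q dq]]|].
  have := congr1 (fun p => (map_poly intr p).[w] : C) dq.
  rewrite rmorphM hornerM dw mul0r map_polyXn hornerXn => /esym/eqP.
  by rewrite expf_eq0 (negPf w0) andbF.
by move=> /unitE [n [q sq]]; exists n, (q * r); rewrite -sq gE {1}fE; ring.
Qed.

(** The image [z] has finite support and its generating polynomial vanishes at
    [w], so it is a multiple of [f]: [z] is the image of an integral bisequence
    of finite support, and [f] is injective on vanishing bisequences. *)
Lemma vanishing_integer_image {C : numClosedFieldType} (f : {poly int}) (w : C)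
    (y : int -> C) (z : int -> int) :
  laurent_irreducible (FracField.tofrac f) ->
  root (map_poly intr f) w -> `|w| = 1 -> vanishing y ->
  (forall k, shift_op (map_poly intr f) y k = (z k)%:~R) ->
  exists h : int -> int, forall k, y k = (h k)%:~R.
Proof.
move=> f_irr fw w1 y0 fy.
have w0 : w != 0 by rewrite -normr_eq0 w1 oner_eq0.
have [N zN] : exists N : nat, forall n : int, (N <= `|n|)%N -> z n = 0.
  apply: (@vanishing_intr C).
  by rewrite -(funext fy); exact: vanishing_shift_op.
have [g fg] := factor_theorem _ _ fw.
pose P := \poly_(l < N + N) z (N%:Z - 1 - l%:Z).
have Pw : root (map_poly intr P) w.
  apply: (generating_poly_root w z (shift_op g y)) => //.
    exact: vanishing_shift_op.
  by move=> k; rewrite -fy fg [g * _]mulrC shift_opXsubCM [RHS]addrC subrK.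
have [n [q Pq]] := laurent_irreducible_dvd f P w f_irr w0 fw Pw.
(* [P] lists [z] backwards from [N - 1], and ['X^n] moves the index by [n]. *)
have zE k : z k = coef_int ('X^n * P) (N%:Z - 1 + n%:Z - k).
  have [kN|kN] := leP N%:Z k.
    rewrite zN; last lia.
    case E: (N%:Z - 1 + n%:Z - k) => [i|//] /=.
    by rewrite coefXnM; case: ltnP => // ni; lia.
  have -> : N%:Z - 1 + n%:Z - k = (n + `|(N%:Z - 1 - k)%R|)%N%:Z by lia.
  rewrite /= coefXnM ltnNge leq_addr /= addKn coef_poly.
  case: ltnP => lN; last by apply: zN; lia.
  by congr z; lia.
pose h k := coef_int q (N%:Z - 1 + n%:Z - k).
exists h => k; apply/eqP; rewrite -subr_eq0; apply/eqP; move: k.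
have f0 : f != 0 by case: f_irr => _ /eqP; rewrite tofrac_eq0.
have zh k : z k = shift_op f h k by rewrite zE Pq coef_intM.
apply: (shift_op_vanishing_eq0 (map_poly intr f)).
- by rewrite map_poly_eq0_id0// intr_eq0 lead_coef_eq0.
- have h0 : vanishing (fun k => (h k)%:~R : C) by exact: vanishing_coef_int.
  have := vanishingD _ _ y0 (vanishingZ (-1) _ h0).
  by under eq_fun do rewrite mulN1r.
- by move=> k; rewrite shift_opB fy zh shift_op_map subrr.
Qed.

(** * Homoclinic points *)

Lemma alpha_iterE (R : realType) (f : {poly int}) (x : X R f) (n k : int) :
  \val (aut_iter (alpha R f) n x) k = \val x (k + n).
Proof.
case: n => n; elim: n k => [|n IH] k.
- by rewrite addr0.
- by rewrite /= /translate IH; congr (\val x _); lia.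
- by rewrite /= /translate; congr (\val x _); lia.
- rewrite -[LHS]/(\val (aut_iter (alpha R f) (Negz n) x) (k - 1)) IH.
  by congr (\val x _); lia.
Qed.

Lemma to_torus0 (R : realType) : to_torus (0 : R) = 0.
Proof. by rewrite -[X in to_torus X](subrr 0) to_torusB subrr. Qed.

Lemma torus_centered_lift (R : realType) (t : torus R) :
  exists2 y : R, t = to_torus y & - (1 / 2) <= y < 1 / 2.
Proof.
have [x ->] := to_torus_surj t.
exists (x - (Num.floor (x + 1 / 2))%:~R).
  by apply/to_torus_eq; rewrite opprB addrC subrK intr_int.
by have /andP[] := floor_itv (x + 1 / 2); rewrite intrD; lra.
Qed.

(** The centered lift tends to 0: when [x n] is the class of some [s] smaller than
    1/2 in absolute value, the lift differs from [s] by an integer less than 1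
    in absolute value. *)
Lemma homoclinic_lift (R : realType) (f : {poly int}) (x : X R f) :
  homoclinic (alpha R f) x ->
  exists2 y : int -> R, (forall n, \val x n = to_torus (y n)) & vanishing y.
Proof.
move=> x0.
have /choice[y yE] : forall n, exists y : R,
    \val x n = to_torus y /\ - (1 / 2) <= y < 1 / 2.
  by move=> n; have [y ? ?] := torus_centered_lift R (\val x n); exists y.
exists y => [n|e e0]; first by case: (yE n).
pose d := Num.min e (1 / 2).
have d0 : 0 < d by rewrite lt_min e0/=; lra.
pose U : set (torus R) := @to_torus R @` ball (0 : R) d.
have U0 : nbhs (0 : torus R) U.
  apply: open_nbhs_nbhs; split; first by apply: to_torus_open; exact: ball_open.
  by exists 0; [exact: ballxx|exact: to_torus0].
have V0 : nbhs (0 : X R f) [set v : X R f | U (\val v 0)].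
  apply: (@val_X_continuous R f 0 [set v : biseq R | U (v 0)]).
  exact: (@biseq_eval_continuous R 0 (\val (0 : X R f))).
have xU : \forall n \near abs_infty, U (\val (aut_iter (alpha R f) n x) 0).
  exact: x0 _ V0.
apply: filterS xU => n /= [s]; rewrite -ball_normE /= sub0r normrN => sd.
rewrite alpha_iterE add0r.
have [-> yn] := yE n; move=> /to_torus_eq /intrP[m sy].
have dh : d <= 1 / 2 by rewrite ge_min lexx orbT.
have de : d <= e by rewrite ge_min lexx.
have m0 : m = 0.
  suff : `|m%:~R : R| < 1.
    rewrite -intr_norm ltrz1 -abszE ltz_nat ltnS leqn0 absz_eq0.
    by move/eqP.
  by rewrite -sy; move: sd yn; rewrite !ltr_norml; lra.
move: sy; rewrite m0 => /eqP; rewrite subr_eq0 => /eqP <-.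
exact: lt_le_trans sd de.
Qed.

Lemma lift_int_image (R : realType) (f : {poly int}) (x : X R f) (y : int -> R) :
  (forall n, \val x n = to_torus (y n)) ->
  forall k, shift_op (map_poly intr f) y k \is a Num.int.
Proof.
move=> xy k; rewrite -[_ k]subr0; apply/to_torus_eq.
have to0 := to_torus0 R.
have toN : {morph @to_torus R : a / - a}.
  by move=> a; rewrite -[- a]sub0r to_torusB to0 sub0r.
have toD : {morph @to_torus R : a b / a + b}.
  by move=> a b; rewrite -[b in LHS]opprK to_torusB toN opprK.
have toMn (a : R) (n : nat) : to_torus (a *+ n) = to_torus a *+ n.
  by elim: n => [|n IH]; rewrite ?mulr0n ?mulrS ?toD ?IH.
have toMz (a : R) (m : int) : to_torus (a *~ m) = to_torus a *~ m.
  by case: m => m; rewrite ?NegzE ?mulrNz ?toN -!pmulrn toMn.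
rewrite to0 -[RHS](set_mem (valP x) k) (@shift_op_widen _ (size f)) ?size_poly//.
rewrite (big_morph _ toD to0); apply: eq_bigr => j _.
by rewrite xy -toMz coef_map mulrzl.
Qed.

Theorem theorem4p1 (R : realType) (f : {poly int})
    (f_deg : (1 < size f)%N) (f_lead : 0 < lead_coef f) (f_0 : f`_0 != 0)
    (f_irr : laurent_irreducible (FracField.tofrac f))
    (f_nonhyp : nonhyperbolic R f) (f_noncyc : ~ cyclotomic R f) :
  homoclinic (alpha R f) = [set 0].
Proof.
apply/seteqP; split=> [x /homoclinic_lift[y xy y0]|_ ->]; last first.
  move=> U /nbhs_singleton U0; exists 0%N => n _ /=.
  have -> // : aut_iter (alpha R f) n 0 = 0.
  by apply: val_inj; apply: funext => k; rewrite alpha_iterE.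
have [w [fw w1]] := f_nonhyp.
pose z k := Num.floor (shift_op (map_poly intr f) y k).
have zE k : shift_op (map_poly intr f) (fun n => (y n)%:C%C) k = (z k)%:~R.
  have -> : map_poly intr f = map_poly (real_complex R) (map_poly intr f).
    by rewrite -map_poly_comp; apply: eq_map_poly => a; rewrite /= rmorph_int.
  rewrite shift_op_map -[RHS](rmorph_int (real_complex R)).
  by congr (_%:C%C); rewrite floorK//; exact: (lift_int_image R f x).
have yC0 : vanishing (fun n => (y n)%:C%C).
  move=> [a b]; rewrite ltcE /= => /andP[/eqP -> a0].
  apply: filterS (y0 _ a0) => n /=.
  by rewrite normc_def /= expr0n addr0 sqrtr_sqr ltcR.
have [h hy] := vanishing_integer_image f w _ z f_irr fw w1 yC0 zE.
apply: val_inj; apply: funext => n; rewrite xy.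
have -> : y n = (h n)%:~R.
  by apply: complexI; rewrite hy rmorph_int.
by rewrite -[RHS]to_torus0; apply/to_torus_eq; rewrite subr0 intr_int.
Qed.
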